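(* Let $n$ be a natural number (positive integer). Then $n$ can be written as the sum of two or more consecutive positive integers, i.e. there exist integers $a \ge 1$ and $m \ge 2$ with $n = a + (a+1) + \cdots + (a+m-1)$, if and only if $n$ is not a power of $2$.
   Context: Natural numbers are positive integers. Powers of $2$ are the numbers $2^d$ with $d \ge 0$ an integer; in particular $1 = 2^0$ is a power of $2$. *)

(* Defs.v *)
From mathcomp Require Import all_boot.

(* Main.v *)
Require Import Defs.
From mathcomp Require Import all_boot.
From mathcomp Require Import zify.

(** Twice a sum of [m] consecutive integers starting at [a] is
    [m * (2a + m - 1)], a product of two factors of opposite parity, both larger
    than 1 when [m >= 2] and [a >= 1]. Conversely, whenever [2n = x * y] with
    [1 < x < y] of opposite parity, solving [x = m], [y = 2a + m - 1] for [a]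
    and [m] gives a representation of [n]. So [n] is representable exactly when
    [2n] has such a factorization.

    One of the two factors is odd and larger than 1, which is impossible
    if [n], hence [2n], is a power of 2 ([odd_dvdn_exp2]). If [n] is not a power
    of 2, then [n = k * 2 ^ d] with [k > 1] odd, and the factors [k] and
    [2 ^ d.+1] of [2n], taken in increasing order, are of the required form
    ([sum_consecutive_of_factors]). *)

Lemma double_sum_consecutive a m :
  (\sum_(i < m) (a + i)).*2 = m * (a.*2 + m.-1).
Proof.
elim: m => [|m IHm]; first by rewrite big_ord0.
by rewrite big_ord_recr /= doubleD IHm; case: m {IHm} => [|m] /=; nia.
Qed.

Lemma odd_dvdn_exp2 k e : odd k -> k %| 2 ^ e -> k = 1.
Proof.
move=> k_odd /gcdn_idPl <-; apply/eqP.
by rewrite -/(coprime k (2 ^ e)) coprimeXr // coprimen2.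
Qed.

(** The opposite parity of [x] and [y] makes [y + 1 - x] even, so that its half
    can serve as the first term; that term is positive because [x < y]. *)
Lemma sum_consecutive_of_factors n x y :
    1 < x -> x < y -> odd (x + y) -> n.*2 = x * y ->
  exists a m : nat, [/\ 1 <= a, 2 <= m & n = \sum_(i < m) (a + i)].
Proof.
move=> x_gt1 ltxy odd_xy n2E; exists (y - x)./2.+1, x; split=> //.
apply: double_inj; rewrite double_sum_consecutive n2E; congr (x * _).
have odd_diff : odd (y - x) by rewrite oddB ?(ltnW ltxy) // addbC -oddD.
by have := odd_double_half (y - x); rewrite odd_diff; lia.
Qed.

Theorem mainTheorem1 (n : nat) (n_gt0 : 0 < n) :
  (exists a m : nat, [/\ 1 <= a, 2 <= m & n = \sum_(i < m) (a + i)])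
  <-> ~ (exists d : nat, n = 2 ^ d).
Proof.
split=> [[a [m [a_gt0 m_gt1 nE]]] [d dE]|not_pow2].
  have prodE : m * (a.*2 + m.-1) = 2 ^ d.+1.
    by rewrite -double_sum_consecutive -nE dE expnS mul2n.
  case: (boolP (odd m)) => m_par.
    by have := odd_dvdn_exp2 m d.+1 m_par; rewrite -prodE dvdn_mulr //; lia.
  have odd_cofactor : odd (a.*2 + m.-1).
    by move: m_par; rewrite -(ltn_predK m_gt1) /= negbK oddD odd_double.
  by have := odd_dvdn_exp2 _ d.+1 odd_cofactor; rewrite -prodE dvdn_mull //; lia.
have [//|k] := @pfactor_coprime 2 n _ n_gt0.
rewrite coprime2n; set d := logn 2 n => k_odd nE.
have k_gt1 : 1 < k.
  case: k k_odd nE => [|[|k]] // _ nE.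
  by case: not_pow2; exists d; rewrite nE mul1n.
have pow_gt1 : 1 < 2 ^ d.+1 by rewrite -{1}(expn0 2) ltn_exp2l.
have n2E : n.*2 = k * 2 ^ d.+1 by rewrite nE expnS -mul2n mulnCA.
have odd_sum : odd (k + 2 ^ d.+1) by rewrite oddD k_odd oddX.
have [ltk|gtk|eqk] := ltngtP k (2 ^ d.+1).
- exact: (sum_consecutive_of_factors _ _ _ k_gt1 ltk odd_sum n2E).
- by apply: (sum_consecutive_of_factors _ _ _ pow_gt1 gtk); rewrite 1?addnC 1?mulnC.
- by rewrite -eqk addnn odd_double in odd_sum.
Qed.
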